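(* Let $R$ be an arbitrary commutative ring, let $m,n,t$ be integers with $2\le t\le m\le n$, and put $r=t-1$. Let $S=R[x_{ij}]_{1\le i\le m,\,1\le j\le n}$, let $I_t\subset S$ be the ideal generated by all $t$-minors of $(x_{ij})$, and let $R[M]=R[w_{il},v_{lj}\mid 1\le i\le m,\ 1\le l\le r,\ 1\le j\le n]$ be the coordinate ring of $M_R=\mathrm{Hom}_R(R^r,R^m)\times\mathrm{Hom}_R(R^n,R^r)$, on which the group scheme $G_R=\mathrm{GL}_{r,R}$ acts by $g\cdot(\varphi,\psi)=(\varphi g^{-1},g\psi)$. Then the canonical $R$-algebra map $S/I_t\to R[M]^{G_R}$ given by $x_{ij}\mapsto\sum_{l=1}^{r}w_{il}v_{lj}$ is an isomorphism.
   Context: $R[M]^{G_R}$ is the ring of scheme-theoretic invariants: the set of $f\in R[M]$ whose pullback under the action morphism $G_R\times_R M_R\to M_R$ equals its pullback under the second projection $G_R\times_R M_R\to M_R$. Equivalently, $f$ is invariant under $\mathrm{GL}_r(A)$ in $A[M]=A\otimes_R R[M]$ for every commutative $R$-algebra $A$. The variables $w_{il}$ and $v_{lj}$ are the matrix-entry coordinates on $\mathrm{Hom}_R(R^r,R^m)$ and $\mathrm{Hom}_R(R^n,R^r)$ respectively. *)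

(* Defs.v *)
From HB Require Import structures.
From mathcomp Require Import all_boot all_order all_algebra.
From mathcomp Require Import boolp.
From mathcomp.multinomials Require Import mpoly.

Set Implicit Arguments.
Unset Strict Implicit.
Unset Printing Implicit Defensive.

Import GRing.Theory.

Local Open Scope ring_scope.
Local Open Scope quotient_scope.

Section DeterminantalRing.

Variables (R : comNzRingType) (m n t : nat).

Local Notation S := {mpoly R[m * n]}.

Definition xmx : 'M[S]_(m, n) := \matrix_(i, j) 'X_(mxvec_index i j).

Definition increasing (k : nat) (f : {ffun 'I_t -> 'I_k}) : bool :=
  [forall i : 'I_t, forall j : 'I_t, (i < j)%N ==> (f i < f j)%N].

(* A t-minor is given by t rows f 0 < f 1 < ... and t columns g 0 < g 1 < ... *)
Definition minor (f : {ffun 'I_t -> 'I_m}) (g : {ffun 'I_t -> 'I_n}) : S :=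
  \det (mxsub f g xmx).

(* The ideal I_t. The unused hypothesis 0 < t makes it a proper ideal, as the
   library's quotient rings require (the empty minor, for t = 0, is 1). *)
Definition det_ideal of (0 < t)%N : {pred S} := fun p =>
  `[< exists c : {ffun 'I_t -> 'I_m} -> {ffun 'I_t -> 'I_n} -> S,
        p = \sum_(f | increasing f) \sum_(g | increasing g) c f g * minor f g >].

Hypothesis t_gt0 : (0 < t)%N.

Lemma det_ideal_closed : idealr_closed (det_ideal t_gt0).
Proof.
split.
- apply/asboolP; exists (fun _ _ => 0).
  by rewrite big1 // => f _; rewrite big1 // => g _; rewrite mul0r.
- apply/negP => /asboolP [c /(congr1 (meval (fun=> 0)))].
  rewrite meval1 raddf_sum big1 => [/eqP|f _]; first by rewrite oner_eq0.
  rewrite raddf_sum big1 // => g _; rewrite /= mevalM -det_map_mx.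
  suff -> : map_mx (meval (fun=> 0)) (mxsub f g xmx) = 0.
    by case: (t) t_gt0 => // k _; rewrite det0 mulr0.
  by apply/matrixP=> i j; rewrite !mxE mevalXU.
- move=> a p q /asboolP [c ->] /asboolP [d ->]; apply/asboolP.
  exists (fun f g => a * c f g + d f g).
  rewrite mulr_sumr -big_split; apply: eq_bigr => f _ /=.
  rewrite mulr_sumr -big_split; apply: eq_bigr => g _ /=.
  by rewrite mulrDl mulrA.
Qed.

HB.instance Definition _ :=
  isIdealr.Build S (det_ideal t_gt0) det_ideal_closed.

Definition det_ring : Type := {ideal_quot (det_ideal t_gt0)}.

HB.instance Definition _ := GRing.ComNzRing.on det_ring.

Definition det_pi : S -> det_ring := \pi_{ideal_quot (det_ideal t_gt0)}.

HB.instance Definition _ := GRing.RMorphism.on det_pi.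

Definition det_scale (a : R) (u : det_ring) : det_ring := det_pi a%:MP * u.

Fact det_scaleA a b u : det_scale a (det_scale b u) = det_scale (a * b) u.
Proof. by rewrite /det_scale mulrA -!rmorphM. Qed.

Fact det_scale1 : left_id 1 det_scale.
Proof. by move=> u; rewrite /det_scale !rmorph1 mul1r. Qed.

Fact det_scaleDr : right_distributive det_scale +%R.
Proof. by move=> a u v; rewrite /det_scale mulrDr. Qed.

Fact det_scaleDl u : {morph det_scale^~ u : a b / a + b}.
Proof. by move=> a b; rewrite /det_scale !rmorphD mulrDl. Qed.

HB.instance Definition _ := GRing.Zmodule_isLmodule.Build R det_ring
  det_scaleA det_scale1 det_scaleDr det_scaleDl.

Fact det_scaleAl (a : R) (u v : det_ring) : a *: (u * v) = (a *: u) * v.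
Proof. exact: mulrA. Qed.

HB.instance Definition _ := GRing.Lmodule_isLalgebra.Build R det_ring
  det_scaleAl.
HB.instance Definition _ := GRing.Lalgebra_isComAlgebra.Build R det_ring.

Fact det_pi_scalable : scalable det_pi.
Proof. by move=> a p; rewrite -mul_mpolyC rmorphM. Qed.

HB.instance Definition _ := GRing.isScalable.Build R S det_ring _ det_pi
  det_pi_scalable.

End DeterminantalRing.

(* The first m * r variables are the w_il, the last r * n are the v_lj. *)
Definition nvarsM (m n r : nat) : nat := m * r + r * n.

Section Action.

Variables (A : comNzRingType) (m n r : nat).

Local Notation N := (nvarsM m n r).

Definition wmx : 'M[{mpoly A[N]}]_(m, r) :=
  \matrix_(i, l) 'X_(lshift (r * n) (mxvec_index i l)).

Definition vmx : 'M[{mpoly A[N]}]_(r, n) :=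
  \matrix_(l, j) 'X_(rshift (m * r) (mxvec_index l j)).

(* substM phi psi f is f(phi, psi). *)
Definition substM (phi : 'M[{mpoly A[N]}]_(m, r))
    (psi : 'M[{mpoly A[N]}]_(r, n)) (f : {mpoly A[N]}) :
    {mpoly A[N]} :=
  f \mPo [tuple row_mx (mxvec phi) (mxvec psi) 0 k | k < N].

(* The pullback along (phi, psi) |-> (phi g^-1, g psi), where ginv is g^-1. *)
Definition actM (g ginv : 'M[A]_r) :
    {mpoly A[N]} -> {mpoly A[N]} :=
  substM (wmx *m map_mx (@mpolyC N A) ginv)
         (map_mx (@mpolyC N A) g *m vmx).

End Action.

Section Invariants.

Variables (R : comNzRingType) (m n r : nat).

(* An element of GL_r(A) is given together with its two-sided inverse, A being
   an arbitrary commutative R-algebra, without decidable units. *)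
Definition GL_invariant : {pred {mpoly R[nvarsM m n r]}} := fun f =>
  `[< forall (A : comAlgType R) (g ginv : 'M[A]_r),
        g *m ginv = 1%:M -> ginv *m g = 1%:M ->
        actM g ginv (map_mpoly (in_alg A) f) = map_mpoly (in_alg A) f >].

Lemma GL_invariant_subalg_closed : subalg_closed GL_invariant.
Proof.
split.
- by apply/asboolP => A g ginv _ _; rewrite /actM /substM !rmorph1.
- move=> a f h /asboolP fI /asboolP hI; apply/asboolP => A g ginv gg' g'g.
  move: (fI A g ginv gg' g'g) (hI A g ginv gg' g'g); rewrite /actM /substM.
  rewrite -mul_mpolyC rmorphD rmorphM rmorphD rmorphM /= => -> ->.
  by rewrite map_mpolyC comp_mpolyC.
- move=> f h /asboolP fI /asboolP hI; apply/asboolP => A g ginv gg' g'g.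
  move: (fI A g ginv gg' g'g) (hI A g ginv gg' g'g); rewrite /actM /substM.
  by rewrite rmorphM rmorphM /= => -> ->.
Qed.

HB.instance Definition _ := GRing.isSubalgClosed.Build R {mpoly R[nvarsM m n r]}
  GL_invariant GL_invariant_subalg_closed.

Record inv_ring : Type :=
  InvRing { inv_val : {mpoly R[nvarsM m n r]}; _ : inv_val \in GL_invariant }.

HB.instance Definition _ := [isSub for inv_val].
HB.instance Definition _ := [Choice of inv_ring by <:].
HB.instance Definition _ := [SubChoice_isSubComNzRing of inv_ring by <:].
HB.instance Definition _ := [SubZmodule_isSubLmodule of inv_ring by <:].
HB.instance Definition _ := [SubNzRing_SubLmodule_isSubLalgebra of inv_ring by <:].
HB.instance Definition _ := GRing.Lalgebra_isComAlgebra.Build R inv_ring.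

End Invariants.

(* Main.v *)
Require Import Defs.
From HB Require Import structures.
From mathcomp Require Import all_boot all_order all_algebra.
From mathcomp Require Import fingroup perm boolp zify ring.
From mathcomp.multinomials Require Import mpoly.

(** Put [r = t - 1], [S = R[x_ij]] and [C = R[w_il, v_lj]], and let
    [prod_map : S -> C] send [x_ij] to the entry [(i, j)] of the product [W V].
    The theorem says that the kernel of [prod_map] is the ideal of the
    [r + 1]-minors and that its image is the ring of invariants.  Both halves
    are arguments on leading monomials for the degree-lexicographic order with
    the variables read row by row.  The leading term of a minor is then its
    diagonal, with coefficient one, so the ring [R] never matters.

    A position [(i, j)] is before [(i', j')] when [i < i'] and [j < j'].  Call a
    monomial of [S] chainless when no [r + 1] positions of its support form a
    chain, that is, when no diagonal of an [r + 1]-minor divides it.  The key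
    fact, [mlead_ker_prod_map], is that the leading monomial of a nonzero [p]
    with [prod_map p = 0] is not chainless.  A chainless [M] has its support
    coloured by [r] colours whose classes are antichains
    ([chain_colouring]).  Let [mu] be the product of [w_ic v_cj] over the
    positions [(i, j)] of [M], [c] being the colour of [(i, j)]; it is a term of
    [prod_map M].  If [mu] occurs in [prod_map M'], then [M'] is a product of
    [r] monomials with the same row and column contents as the colour classes
    of [M].  Among all monomials with given contents an antichain is the
    smallest ([antichain_minimal]), so [M <= M'], and when [M = M'] the term
    [mu] arises only once.  Hence, if [M] is the leading monomial of [p], the
    coefficient of [mu] in [prod_map p] is the leading coefficient of [p].

    Kernel: the [r + 1]-minors of [W V] vanish, and a [p] in the kernel loses
    its leading monomial by subtracting a multiple of a minor; this goes on
    until [p] is exhausted ([ker_prod_map_sub]).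

    Image: let [f] be invariant and choose [r] rows and [r] columns, with minor
    [D].  Over the localization of [C] at the determinant of the chosen rows of
    [W], the group element [g] given by these rows shows
    [f (W, V) = f (W g^-1, g V)].  The entries of [g V] are entries of [W V],
    and those of [D W g^-1] are polynomials in the entries of [W V], so
    [D ^ k f] is in the image for some [k]
    ([invariant_bounded_denominator]).  Take for [D] and [D'] the minors in
    the north-east and the south-west corner.  A chain of length [r + 1] never
    meets their diagonals, so multiplication by these diagonals keeps chainless
    monomials chainless, and the key fact turns this into: [D, D'] is a regular
    sequence on the image ([chain_det_regular]).  Having both a power of [D]
    and a power of [D'] as a denominator, [f] is in the image. *)

Set Implicit Arguments.
Unset Strict Implicit.
Unset Printing Implicit Defensive.

Import Order.TTheory GRing.Theory.
Local Open Scope ring_scope.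
Local Open Scope quotient_scope.

(** * Matrix positions and the monomial order *)

Section Positions.

Variables m n : nat.

(** The monomial order compares exponents variable after variable; this value
    makes it run through the matrix row by row. *)
Lemma val_mxvec_index (i : 'I_m) (j : 'I_n) :
  mxvec_index i j = (i * n + j)%N :> nat.
Proof.
have rankE (T : finType) (x : T) : enum_rank x = index x (enum T) :> nat.
  by rewrite -{2}(nth_enum_rank x x) index_uniq ?enum_uniq // -cardE ltn_ord.
have indexE (T1 T2 : eqType) (x : T1) (y : T2) s1 s2 :
    x \in s1 -> y \in s2 ->
  index (x, y) [seq (u, v) | u <- s1, v <- s2]
    = (index x s1 * size s2 + index y s2)%N.
  move=> xs ys; elim: s1 xs => //= u s1 IH; rewrite inE index_cat.
  have -> : ((x, y) \in [seq (u, v) | v <- s2]) = (x == u).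
    by apply/mapP/eqP => [[v _ [->]]//|->]; exists y.
  have [<- _|neq] := eqVneq x u.
    by rewrite index_map => [|v w [->]].
  by move=> /= /IH ->; rewrite size_map mulSn addnA.
rewrite /= rankE enumT unlock /= /prod_enum indexE ?mem_enum //.
by rewrite !index_enum_ord size_enum_ord.
Qed.

Definition row_of (k : 'I_(m * n)) : 'I_m :=
  (enum_val (cast_ord (esym (mxvec_cast m n)) k)).1.

Definition col_of (k : 'I_(m * n)) : 'I_n :=
  (enum_val (cast_ord (esym (mxvec_cast m n)) k)).2.

Lemma row_of_index i j : row_of (mxvec_index i j) = i.
Proof. by rewrite /row_of cast_ordK enum_rankK. Qed.

Lemma col_of_index i j : col_of (mxvec_index i j) = j.
Proof. by rewrite /col_of cast_ordK enum_rankK. Qed.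

Lemma eq_mxvec_index (i i' : 'I_m) (j j' : 'I_n) :
  (mxvec_index i j == mxvec_index i' j') = (i == i') && (j == j').
Proof.
apply/eqP/andP => [eq_ij|[/eqP-> /eqP->]//].
have := (congr1 row_of eq_ij, congr1 col_of eq_ij).
by rewrite !row_of_index !col_of_index => -[-> ->].
Qed.

Lemma index_row_col k : mxvec_index (row_of k) (col_of k) = k.
Proof. by case/mxvec_indexP: k => i j; rewrite row_of_index col_of_index. Qed.

Lemma val_row_col (k : 'I_(m * n)) : k = (row_of k * n + col_of k)%N :> nat.
Proof. by rewrite -{1}(index_row_col k) val_mxvec_index. Qed.

Lemma ltn_mxvec_index (i i' : 'I_m) (j j' : 'I_n) :
  (i < i')%N || (i == i') && (j < j')%N ->
  (mxvec_index i j < mxvec_index i' j')%N.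
Proof.
rewrite !val_mxvec_index; have := ltn_ord j.
by move=> ltj /orP [|/andP [/eqP <-]]; [nia | lia].
Qed.

Lemma leq_positions (k k' : 'I_(m * n)) :
  (row_of k <= row_of k')%N -> (col_of k <= col_of k')%N -> (k <= k')%N.
Proof. by rewrite (val_row_col k) (val_row_col k'); nia. Qed.

Definition before (k k' : 'I_(m * n)) : bool :=
  (row_of k < row_of k')%N && (col_of k < col_of k')%N.

(** Suppose [b < a] and let [k0] be the first position where they differ.  The
    sums of [a] and [b] over the quadrant north-west of [k0] differ only at
    [k0], where [b] is smaller.  As row and column sums agree, the sum of [b]
    over the quadrant strictly south-east of [k0] is smaller by the same amount
    than that of [a]; but [a] vanishes there, since it contains [k0]. *)
Lemma antichain_minimal (a b : 'X_{1..m * n}) :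
  (forall k k', a k != 0%N -> a k' != 0%N -> ~~ before k k') ->
  (forall i, \sum_(k | row_of k == i) a k = \sum_(k | row_of k == i) b k)%N ->
  (forall j, \sum_(k | col_of k == j) a k = \sum_(k | col_of k == j) b k)%N ->
  (a <= b)%O.
Proof.
move=> anti rows cols; rewrite leNgt; apply/negP.
have sum_fibres (T : finType) (h : 'I_(m * n) -> T) (P : pred T) :
    (forall x, \sum_(k | h k == x) a k = \sum_(k | h k == x) b k)%N ->
  (\sum_(k | P (h k)) a k = \sum_(k | P (h k)) b k)%N.
  move=> fibres; rewrite !(partition_big h P) //; apply: eq_bigr => x Px.
  have hx k : P (h k) && (h k == x) = (h k == x).
    by case: eqP => [->|_]; rewrite ?andbT ?andbF.
  by rewrite (eq_bigl _ _ hx) (eq_bigl _ _ hx).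
have tot : (\sum_k a k = \sum_k b k)%N by exact: sum_fibres xpredT rows.
move=> /ltmcP -[|k0 eq_lt lt_k0]; first by rewrite !mdegE.
pose inR k := (row_of k <= row_of k0)%N.
pose inC k := (col_of k <= col_of k0)%N.
have inclexcl (f : 'I_(m * n) -> nat) :
    (\sum_(k | inR k) f k + \sum_(k | inC k) f k
      + \sum_(k | ~~ inR k && ~~ inC k) f k
     = \sum_k f k + \sum_(k | inR k && inC k) f k)%N.
  rewrite [(\sum_(k | inR k) _)%N]big_mkcond [(\sum_(k | inC k) _)%N]big_mkcond.
  rewrite [(\sum_(k | ~~ _ && _) _)%N]big_mkcond.
  rewrite [(\sum_(k | inR k && _) _)%N]big_mkcond.
  rewrite -!big_split /=.
  by apply: eq_bigr => k _; case: (inR k); case: (inC k) => /=; lia.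
have eqR : (\sum_(k | inR k) a k = \sum_(k | inR k) b k)%N.
  exact: (sum_fibres _ _ (fun i : 'I_m => i <= row_of k0)%N rows).
have eqC : (\sum_(k | inC k) a k = \sum_(k | inC k) b k)%N.
  exact: (sum_fibres _ _ (fun j : 'I_n => j <= col_of k0)%N cols).
have := inclexcl a; have := inclexcl b; rewrite eqR eqC tot.
rewrite [X in (_ + X)%N = (_ + \sum_(k | _) a k)%N]big1; last first.
  move=> k; rewrite -!ltnNge => lt_k; apply/eqP/negP => /negP ak.
  have := anti k0 k _ ak; rewrite /before lt_k => H; suff: false by [].
  by apply: H; rewrite -lt0n (leq_ltn_trans _ lt_k0).
have : (\sum_(k | inR k && inC k) b k < \sum_(k | inR k && inC k) a k)%N.
  have P0 : inR k0 && inC k0 by rewrite /inR /inC !leqnn.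
  rewrite !(bigD1 k0 P0) /= -addSn leq_add // leq_sum // => k.
  case/andP => /andP [rk ck] nk.
  have := leq_positions rk ck; rewrite leq_eqVlt => /orP [/eqP/val_inj kk|lt_k].
    by rewrite kk eqxx in nk.
  by rewrite eq_lt.
by rewrite addn0; lia.
Qed.

End Positions.

(** * Leading terms of determinants *)

Lemma mpolyX_sum (N : nat) (R : nzRingType) (I : Type) (s : seq I) (P : pred I)
    (F : I -> 'X_{1..N}) :
  'X_[\sum_(i <- s | P i) F i] = \prod_(i <- s | P i) 'X_[F i] :> {mpoly R[N]}.
Proof. exact: (big_morph _ (@mpolyXD _ _) (@mpolyX0 _ _)). Qed.

Section LeadingTermOfDeterminant.

Variables (N d : nat) (h : 'I_d -> 'I_d -> 'I_N).

Hypothesis h_mono : forall i j i' j' : 'I_d,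
  (i < i')%N || (i == i') && (j < j')%N -> (h i j < h i' j')%N.

(** At the first index [i0] moved by [s], the term of [s] picks in row [i0] a
    variable to the right of the diagonal; all variables up to the diagonal one
    of row [i0] then occur at least as often in the diagonal term. *)
Lemma diagonal_term_max (s : 'S_d) : s != 1%g ->
  ((\sum_i U_(h i (s i)))%MM < (\sum_i U_(h i i))%MM)%O.
Proof.
move=> s_neq1; apply/ltmcP.
  by rewrite !mdeg_sum; apply: eq_bigr => i _; rewrite !mdeg1.
have [i1 i1P] : exists i, s i != i.
  apply/existsP; apply: contraR s_neq1 => /existsPn fix_s.
  apply/eqP/permP => i.
  by rewrite perm1; apply/eqP; rewrite -[_ == _]negbK fix_s.
case: (@arg_minnP _ i1 (fun i => s i != i) (fun i : 'I_d => i : nat) i1P).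
move=> i0 s_i0 i0_min.
have s_fix (i : 'I_d) : (i < i0)%N -> s i = i.
  by move=> lt_i; apply/eqP; apply: contraLR lt_i => /i0_min; rewrite -leqNgt.
have gt_s : (i0 < s i0)%N.
  rewrite ltn_neqAle eq_sym s_i0 leqNgt; apply/negP => /s_fix/perm_inj/eqP.
  by apply/negP.
have far (i : 'I_d) : (i0 <= i)%N -> (h i0 i0 < h i (s i))%N.
  rewrite leq_eqVlt => /orP [/eqP/val_inj <-|lt_i]; apply: h_mono.
    by rewrite eqxx gt_s orbT.
  by rewrite lt_i.
exists (h i0 i0) => [k lt_k|].
  rewrite !mnm_sumE; apply: eq_bigr => i _; rewrite !mnm1E.
  have [/s_fix ->//|le_i] := ltnP i i0.
  rewrite -!val_eqE /= !gtn_eqF //; last exact: ltn_trans (far _ le_i).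
  apply: leq_trans lt_k _; move: le_i.
  rewrite leq_eqVlt => /orP [/eqP/val_inj <-//|lt_i].
  by apply/ltnW/h_mono; rewrite lt_i.
rewrite !mnm_sumE big1 => [|i _]; first by rewrite (bigD1 i0) //= mnm1E eqxx.
rewrite mnm1E -val_eqE /=; have [lt_i|/far/gtn_eqF ->//] := ltnP i i0.
by rewrite s_fix // ltn_eqF // h_mono // lt_i.
Qed.

Variable R : comNzRingType.

Let D : {mpoly R[N]} := \det (\matrix_(i, j) 'X_(h i j)).

Lemma det_diagonal_expand :
  D = 'X_[\sum_i U_(h i i)]
    + \sum_(s : 'S_d | s != 1%g) (-1) ^+ s *: 'X_[\sum_i U_(h i (s i))].
Proof.
rewrite /D /determinant (bigD1 1%g) //= odd_perm1 mul1r mpolyX_sum.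
congr (_ + _).
  by apply: eq_bigr => i _; rewrite mxE perm1.
apply: eq_bigr => s _; rewrite -mul_mpolyC mpolyX_sum rmorphXn /= rmorphN1.
by congr (_ * _); apply: eq_bigr => i _; rewrite mxE.
Qed.

Lemma mleadc_det_diagonal : D@_(\sum_i U_(h i i)) = 1.
Proof.
rewrite det_diagonal_expand mcoeffD mcoeffX eqxx raddf_sum big1 ?addr0 //=.
move=> s s_neq1; rewrite mcoeffZ mcoeffX lt_eqF ?mulr0 //.
exact: diagonal_term_max.
Qed.

Lemma mlead_det_diagonal : mlead D = (\sum_i U_(h i i))%MM.
Proof.
apply/le_anti/andP; split; last first.
  by apply: msupp_le_mlead; rewrite mcoeff_msupp mleadc_det_diagonal oner_neq0.
rewrite det_diagonal_expand; apply: le_trans (mleadD_le _ _) _.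
rewrite leUx mleadXm lexx /=; apply: le_trans (mlead_sum_le _ _ _) _.
apply/joinsP => s s_neq1; apply: le_trans (mleadZ_le _ _) _.
by rewrite mleadXm ltW // diagonal_term_max.
Qed.

Lemma lreg_det_diagonal : GRing.lreg D.
Proof.
apply: lreg_mleadc; rewrite mlead_det_diagonal mleadc_det_diagonal.
exact: lreg1.
Qed.

End LeadingTermOfDeterminant.

(** * The key fact: leading monomials of the kernel *)

(** Mirsky's theorem: colour [0] goes to the minimal elements of [P].  A chain
    of other elements is extended downwards by an element of [P], so that the
    others contain only shorter chains. *)
Lemma chain_colouring (T : finType) (lt : rel T) (r : nat) (P : pred T) :
  (forall s, all P s -> sorted lt s -> (size s <= r)%N) ->
  exists2 kappa : T -> nat, forall x, P x -> (kappa x < r)%N &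
    forall x y, P x -> P y -> lt x y -> kappa x != kappa y.
Proof.
elim: r P => [|r IH] P chains.
  have P0 x : P x -> False.
    by move=> Px; have := chains [:: x]; rewrite /= Px => /(_ isT isT).
  by exists (fun=> 0%N) => [x /P0|x y /P0].
pose Q x := P x && [exists z, P z && lt z x].
have [s Qs ss|kappa kappa_lt kappa_neq] := IH Q.
  case: s Qs ss => // x s /= /andP [/andP [Px /existsP [z]]].
  move=> /andP [Pz zx] Qs ss.
  apply: (chains [:: z, x & s]); rewrite /= ?Pz ?Px ?zx //=.
  by apply: sub_all Qs => y /andP [].
exists (fun x => if Q x then (kappa x).+1 else 0%N) => [x Px|x y Px Py xy].
  by case: ifP => // /kappa_lt.
have -> : Q y by rewrite /Q Py; apply/existsP; exists x; rewrite Px.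
case: ifP => // Qx; rewrite eqSS; apply: kappa_neq => //.
by rewrite /Q Py; apply/existsP; exists x; rewrite Px.
Qed.

Lemma mnm_sum_seq (N : nat) (M : 'X_{1..N}) :
  M = (\sum_(l < size (m2s M)) U_(tnth (in_tuple (m2s M)) l))%MM.
Proof.
rewrite -[LHS]s2mK; apply/mnmP => k.
rewrite mnmE mnm_sumE -(big_tnth _ _ _ xpredT (fun i => U_(i)%MM k)) /=.
rewrite -sum1_count big_mkcond; apply: eq_bigr => i _; rewrite mnm1E /=.
by case: eqP.
Qed.

Lemma eq_summands (N : nat) (I : finType) (a b : I -> 'X_{1..N}) :
  (forall c, (a c <= b c)%O) -> (\sum_c a c = \sum_c b c)%MM -> a =1 b.
Proof.
move=> ab sum_ab c; apply/eqP; apply: contraT => neq_c.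
have: ((\sum_c a c)%MM < (\sum_c b c)%MM)%O.
  rewrite !(bigD1 c (P := xpredT)) //= ltmc_le_add //.
    by rewrite lt_neqAle neq_c ab.
  by elim/big_rec2: _ => // i x y _ xy; apply: lem_add.
by rewrite sum_ab ltxx.
Qed.

Section MultiplicationMap.

Variables (R : comNzRingType) (m n r : nat).

Local Notation N := (nvarsM m n r).
Local Notation S := {mpoly R[m * n]}.
Local Notation C := {mpoly R[N]}.
Local Notation W := (wmx R m n r).
Local Notation V := (vmx R m n r).

Definition prod_map : S -> C :=
  comp_mpoly [tuple mxvec (W *m V) 0 k | k < m * n].

HB.instance Definition _ := GRing.RMorphism.on prod_map.
HB.instance Definition _ := GRing.Linear.on prod_map.

Arguments prod_map : simpl never.

Lemma prod_map_xmx i j : prod_map (xmx R m n i j) = (W *m V) i j.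
Proof.
by rewrite /prod_map mxE comp_mpolyXU nth_mktuple mxvecE.
Qed.

Lemma map_prod_map_xmx : map_mx prod_map (xmx R m n) = W *m V.
Proof. by apply/matrixP => i j; rewrite mxE prod_map_xmx. Qed.

Definition wvar (i : 'I_m) (c : 'I_r) : 'I_N :=
  lshift (r * n) (mxvec_index i c).
Definition vvar (c : 'I_r) (j : 'I_n) : 'I_N :=
  rshift (m * r) (mxvec_index c j).

Lemma eq_wvar i c i' c' : (wvar i c == wvar i' c') = (i == i') && (c == c').
Proof.
by rewrite /wvar (inj_eq (@lshift_inj _ _)) eq_mxvec_index.
Qed.

Lemma eq_vvar c j c' j' : (vvar c j == vvar c' j') = (c == c') && (j == j').
Proof.
by rewrite /vvar (inj_eq (@rshift_inj _ _)) eq_mxvec_index.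
Qed.

Lemma eq_wvar_vvar i c c' j : (wvar i c == vvar c' j) = false.
Proof. exact: eq_lrshift. Qed.

Definition coloured_mnm (c : 'I_r) (k : 'I_(m * n)) : 'X_{1..N} :=
  (U_(wvar (row_of k) c) + U_(vvar c (col_of k)))%MM.

Lemma prod_mapXU k : prod_map 'X_k = \sum_c 'X_[coloured_mnm c k].
Proof.
case/mxvec_indexP: k => i j; have := prod_map_xmx i j; rewrite mxE => ->.
rewrite mxE; apply: eq_bigr => c _.
by rewrite !mxE /coloured_mnm mpolyXD row_of_index col_of_index.
Qed.

(** The terms of the image of [M] are indexed by the colourings [phi] of the
    positions of [M], listed with multiplicity. *)
Lemma prod_mapX M (s := in_tuple (m2s M)) :
  prod_map 'X_[M] = \sum_(phi : {ffun 'I_(size (m2s M)) -> 'I_r})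
    'X_[\sum_l coloured_mnm (phi l) (tnth s l)].
Proof.
rewrite {1}[M]mnm_sum_seq mpolyX_sum rmorph_prod /=.
rewrite (eq_bigr (fun l => \sum_c 'X_[coloured_mnm c (tnth s l)])); last first.
  by move=> l _; rewrite prod_mapXU.
by rewrite bigA_distr_bigA /=; apply: eq_bigr => phi _; rewrite mpolyX_sum.
Qed.

Section Layers.

Variables (d : nat) (s : d.-tuple 'I_(m * n)) (phi : 'I_d -> 'I_r).

Let content : 'X_{1..N} := (\sum_l coloured_mnm (phi l) (tnth s l))%MM.

(** The part of the monomial with colour [c].  Its row and column sums are the
    exponents of the [w_ic] and of the [v_cj] in the term given by [phi]. *)
Definition layer (c : 'I_r) : 'X_{1..m * n} :=
  (\sum_(l | phi l == c) U_(tnth s l))%MM.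

Lemma sum_layers : (\sum_c layer c = \sum_l U_(tnth s l))%MM.
Proof. by rewrite [RHS](partition_big phi xpredT). Qed.

Lemma layer_neq0 c k : layer c k != 0%N -> exists2 l, tnth s l = k & phi l = c.
Proof.
rewrite mnm_sumE sum_nat_eq0 negb_forall => /existsP [l].
by rewrite negb_imply mnm1E eqb0 negbK => /andP [/eqP pl /eqP sl]; exists l.
Qed.

Lemma content_wvar i c :
  content (wvar i c) = (\sum_(k | row_of k == i) layer c k)%N.
Proof.
under [RHS]eq_bigr do rewrite mnm_sumE.
rewrite mnm_sumE exchange_big big_mkcond [RHS]big_mkcond /=.
apply: eq_bigr => l _.
rewrite mnmDE !mnm1E eq_wvar [vvar _ _ == _]eq_sym eq_wvar_vvar addn0.
case: (phi l == c); rewrite ?andbF // andbT.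
under eq_bigr do rewrite mnm1E.
case: eqP => [<-|neq].
  rewrite (bigD1 (tnth s l)) //= eqxx big1 // => k /andP [_].
  by rewrite eq_sym => /negPf ->.
by rewrite big1 // => k /eqP rk; case: eqP => // sk; rewrite sk rk in neq.
Qed.

Lemma content_vvar j c :
  content (vvar c j) = (\sum_(k | col_of k == j) layer c k)%N.
Proof.
under [RHS]eq_bigr do rewrite mnm_sumE.
rewrite mnm_sumE exchange_big big_mkcond [RHS]big_mkcond /=.
apply: eq_bigr => l _.
rewrite mnmDE !mnm1E eq_vvar eq_wvar_vvar add0n.
case: (phi l == c) => //=.
under eq_bigr do rewrite mnm1E.
case: eqP => [<-|neq].
  rewrite (bigD1 (tnth s l)) //= eqxx big1 // => k /andP [_].
  by rewrite eq_sym => /negPf ->.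
by rewrite big1 // => k /eqP rk; case: eqP => // sk; rewrite sk rk in neq.
Qed.

End Layers.

Definition has_chain (d : nat) (M : 'X_{1..m * n}) : bool :=
  [exists s : d.-tuple 'I_(m * n),
     sorted (@before m n) s && all (fun k => M k != 0%N) s].

Lemma chainless_colouring M : (0 < r)%N -> ~~ has_chain r.+1 M ->
  exists kappa : 'I_(m * n) -> 'I_r, forall k k',
    M k != 0%N -> M k' != 0%N -> before k k' -> kappa k != kappa k'.
Proof.
move=> r_gt0 chainless; pose P k := M k != 0%N.
have [s Ps ss|kappa kappa_lt kappa_neq] := @chain_colouring _ (@before m n) r P.
  rewrite leqNgt; apply: contra chainless => lt_r; apply/existsP.
  have size_s : size (take r.+1 s) == r.+1 by rewrite size_takel.
  exists (Tuple size_s); rewrite /= take_sorted //=.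
  by apply/allP => k /mem_take; apply/allP: k.
(* Positions outside the support may get the default colour. *)
exists (fun k => insubd (Ordinal r_gt0) (kappa k)) => k k' Pk Pk' kk'.
rewrite -val_eqE /= !val_insubd !kappa_lt //; exact: kappa_neq.
Qed.

Section ColouredMonomial.

Variables (M : 'X_{1..m * n}) (kappa : 'I_(m * n) -> 'I_r).

Hypothesis kappa_neq : forall k k',
  M k != 0%N -> M k' != 0%N -> before k k' -> kappa k != kappa k'.

Definition colour_content : 'X_{1..N} :=
  let s := in_tuple (m2s M) in
  (\sum_l coloured_mnm (kappa (tnth s l)) (tnth s l))%MM.

(** Colour by colour, the two layers have the same row and column sums, and the
    one of [M] is an antichain; so it is the smaller one.  If the products of
    the layers agree, then so do the layers, and the colour of each position is
    forced. *)
Lemma colour_content_minimal d (s : d.-tuple 'I_(m * n)) (phi : 'I_d -> 'I_r) :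
  (\sum_l coloured_mnm (phi l) (tnth s l))%MM = colour_content ->
  (M <= (\sum_l U_(tnth s l))%MM)%O /\
  (M = (\sum_l U_(tnth s l))%MM -> forall l, phi l = kappa (tnth s l)).
Proof.
move=> same_content; set s0 := in_tuple (m2s M).
pose a := layer s0 (fun l => kappa (tnth s0 l)); pose b := layer s phi.
have sum_a : M = (\sum_c a c)%MM by rewrite sum_layers -mnm_sum_seq.
have a_neq0 c k : a c k != 0%N -> kappa k = c /\ M k != 0%N.
  move=> ack; split; first by have [l <-] := layer_neq0 ack.
  by rewrite sum_a mnm_sumE (bigD1 c) //= addn_eq0 negb_and ack.
have ab c : (a c <= b c)%O.
  apply: antichain_minimal => [k k' /a_neq0 [kc Mk] /a_neq0 [k'c Mk']|i|j].
  - by apply/negP => /kappa_neq; rewrite Mk Mk' kc k'c eqxx => /(_ isT isT).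
  - by rewrite -!content_wvar same_content.
  - by rewrite -!content_vvar same_content.
rewrite -(sum_layers s phi) sum_a; split.
  by elim/big_rec2: _ => // c x y _ xy; apply: lem_add.
move=> /(eq_summands ab) eq_ab l.
have [] // := a_neq0 (phi l) (tnth s l).
by rewrite eq_ab mnm_sumE (bigD1 l) //= mnm1E eqxx.
Qed.

Lemma mcoeff_colour_content_lt M' :
  (M' < M)%O -> (prod_map 'X_[M'])@_colour_content = 0.
Proof.
move=> lt_M; rewrite prod_mapX raddf_sum big1 //= => phi _.
rewrite mcoeffX; case: eqP => // /colour_content_minimal [+ _].
by rewrite -mnm_sum_seq leNgt lt_M.
Qed.

Lemma mcoeff_colour_content : (prod_map 'X_[M])@_colour_content = 1.
Proof.
pose phi0 := [ffun l => kappa (tnth (in_tuple (m2s M)) l)].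
rewrite prod_mapX raddf_sum (bigD1 phi0) //=.
rewrite [X in _ + X]big1 ?addr0 => [|phi neq_phi].
  rewrite mcoeffX [X in X == _](_ : _ = colour_content) ?eqxx //.
  by apply: eq_bigr => l _; rewrite ffunE.
rewrite mcoeffX; case: eqP => // /colour_content_minimal [_ eq_phi].
case/eqP: neq_phi; apply/ffunP => l; rewrite ffunE.
by apply: eq_phi; rewrite -mnm_sum_seq.
Qed.

End ColouredMonomial.

(** Smaller monomials of [p] do not contribute to the coefficient of the content
    of its leading one, which would be chainless otherwise. *)
Lemma mlead_ker_prod_map p : (0 < r)%N ->
  p != 0 -> prod_map p = 0 -> has_chain r.+1 (mlead p).
Proof.
move=> r_gt0 p_neq0 ker_p; apply: contraT => /(chainless_colouring r_gt0).
case=> kappa kappa_neq; set M := mlead p in kappa_neq; case/eqP: p_neq0.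
apply/eqP; rewrite -mleadc_eq0 -/M; apply/eqP.
have expand : prod_map p = \sum_(M' <- msupp p) p@_M' *: prod_map 'X_[M'].
  by rewrite {1}[p]mpolyE linear_sum; apply: eq_bigr => M' _; rewrite linearZ.
have := congr1 (mcoeff (colour_content M kappa)) ker_p.
rewrite mcoeff0 expand linear_sum.
have [Mp|/memN_msupp_eq0 ->//] := boolP (M \in msupp p).
rewrite (bigD1_seq M) ?msupp_uniq //= mcoeffZ mcoeff_colour_content // mulr1.
rewrite big_seq_cond big1 ?addr0 // => M' /andP [M'p neq_M].
rewrite mcoeffZ mcoeff_colour_content_lt ?mulr0 //.
by rewrite lt_neqAle neq_M msupp_le_mlead.
Qed.

End MultiplicationMap.

(** * The kernel is generated by minors *)

Section CancelLeadingTerm.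

Variables (N : nat) (R : comNzRingType).

(** The zero polynomial has to be set apart: its leading monomial is that of a
    constant. *)
Lemma mlead_cancel (p D : {mpoly R[N]}) :
  D@_(mlead D) = 1 -> (mlead D <= mlead p)%MM ->
  exists e, p - e * D = 0 \/ (mlead (p - e * D) < mlead p)%O.
Proof.
move=> monic_D lead_Dp; have [->|p_neq0] := eqVneq p 0.
  by exists 0; left; rewrite mul0r subr0.
pose e := p@_(mlead p) *: 'X_[mlead p - mlead D]; exists e.
have lead_e : mlead e = (mlead p - mlead D)%MM.
  by rewrite mleadZ_proper mleadXm // mcoeffX eqxx mulr1 mleadc_eq0.
have lc_e : e@_(mlead e) = p@_(mlead p).
  by rewrite lead_e mcoeffZ mcoeffX eqxx mulr1.
have lead_eD : mlead (e * D) = mlead p.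
  rewrite mleadM_proper ?lead_e ?submK // monic_D mulr1 -lead_e lc_e.
  by rewrite mleadc_eq0.
have [|lt_mlead] := leP (mlead p) (mlead (p - e * D)); last by right.
move=> ge_lead; left; apply/eqP; rewrite -mleadc_eq0.
have -> : mlead (p - e * D) = mlead p.
  apply/le_anti; rewrite ge_lead andbT (le_trans (mleadB_le _ _)) //.
  by rewrite lead_eD leUx lexx.
rewrite mcoeffB -{2}lead_eD mleadcM_proper ?lc_e ?monic_D ?mulr1 ?subrr //.
by rewrite mleadc_eq0.
Qed.

End CancelLeadingTerm.

Section ChainMinors.

Variables (R : comNzRingType) (m n : nat).

Lemma before_trans : transitive (@before m n).
Proof.
move=> y x z /andP [xy1 xy2] /andP [yz1 yz2].
by rewrite /before (ltn_trans xy1) ?(ltn_trans xy2).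
Qed.

Section OneChain.

Variables (d : nat) (s : d.-tuple 'I_(m * n)).

Definition chain_mnm : 'X_{1..m * n} := (\sum_i U_(tnth s i))%MM.

Definition chain_det : {mpoly R[m * n]} :=
  \det (mxsub (fun i => row_of (tnth s i)) (fun j => col_of (tnth s j))
    (xmx R m n)).

Lemma chain_detE : chain_det = \det (\matrix_(i, j)
  'X_(mxvec_index (row_of (tnth s i)) (col_of (tnth s j)))).
Proof. by congr (\det _); apply/matrixP => i j; rewrite !mxE. Qed.

Hypothesis chain_s : sorted (@before m n) s.

Lemma before_tnth (i j : 'I_d) : (i < j)%N -> before (tnth s i) (tnth s j).
Proof.
move=> ij; have x0 := tnth s i; rewrite !(tnth_nth x0).
by apply: (sorted_ltn_nth before_trans) => //; rewrite inE size_tuple.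
Qed.

Lemma chain_index_mono (i j i' j' : 'I_d) :
  (i < i')%N || (i == i') && (j < j')%N ->
  (mxvec_index (row_of (tnth s i)) (col_of (tnth s j))
     < mxvec_index (row_of (tnth s i')) (col_of (tnth s j')))%N.
Proof.
move=> lt_ij; apply: ltn_mxvec_index; case/orP: lt_ij => [|/andP [/eqP-> ]].
  by move=> /before_tnth /andP [-> _].
by move=> /before_tnth /andP [_ ->]; rewrite eqxx orbT.
Qed.

Lemma mlead_chain_det : mlead chain_det = chain_mnm.
Proof.
rewrite chain_detE (mlead_det_diagonal chain_index_mono).
by apply: eq_bigr => i _; rewrite index_row_col.
Qed.

Lemma mleadc_chain_det : chain_det@_(mlead chain_det) = 1.
Proof.
rewrite chain_detE (mlead_det_diagonal chain_index_mono).
by rewrite (mleadc_det_diagonal chain_index_mono).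
Qed.

Lemma mleadM_chain_det p : p != 0 ->
  mlead (chain_det * p) = (chain_mnm + mlead p)%MM.
Proof.
move=> p_neq0; rewrite mleadM_proper ?mlead_chain_det //.
by rewrite -mlead_chain_det mleadc_chain_det mul1r mleadc_eq0.
Qed.

Lemma lreg_chain_det : GRing.lreg chain_det.
Proof. by rewrite chain_detE; exact: (lreg_det_diagonal chain_index_mono). Qed.

Lemma uniq_chain : uniq s.
Proof.
apply: (sorted_uniq before_trans) chain_s => k.
by rewrite /before ltnn.
Qed.

Lemma chain_mnmE k : chain_mnm k = (k \in s) :> nat.
Proof.
rewrite /chain_mnm mnm_sumE -(big_tuple _ _ s xpredT (fun i => U_(i)%MM k)) /=.
rewrite -(count_uniq_mem k uniq_chain) -sum1_count [RHS]big_mkcond.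
by apply: eq_bigr => i _; rewrite mnm1E /=; case: eqP.
Qed.

Lemma chain_mnm_le M : (chain_mnm <= M)%MM = all (fun k => M k != 0%N) s.
Proof.
apply/mnm_lepP/allP => [le_M k ks|nz k].
  by rewrite -lt0n (leq_trans _ (le_M k)) // chain_mnmE ks.
by rewrite chain_mnmE; case: (boolP (k \in s)) => // /nz; rewrite lt0n.
Qed.

End OneChain.

Variable r : nat.

Local Notation pm := (@prod_map R m n r).

Lemma map_prod_map_mxsub a b (f : 'I_a -> 'I_m) (g : 'I_b -> 'I_n) :
  map_mx pm (mxsub f g (xmx R m n))
    = rowsub f (wmx R m n r) *m colsub g (vmx R m n r).
Proof.
rewrite map_mxsub map_prod_map_xmx; apply/matrixP => i j; rewrite !mxE.
by apply: eq_bigr => l _; rewrite !mxE.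
Qed.

Lemma prod_map_det0 (f : 'I_r.+1 -> 'I_m) (g : 'I_r.+1 -> 'I_n) :
  pm (\det (mxsub f g (xmx R m n))) = 0.
Proof.
rewrite -det_map_mx map_prod_map_mxsub.
set W' := rowsub f _; set V' := colsub g _.
(* Padding by a zero column makes the two factors square. *)
have -> : W' *m V' = (row_mx 0 W' : 'M_(r.+1, 1 + r)) *m col_mx 0 V'.
  by rewrite mul_row_col mul0mx add0r.
rewrite det_mulmx (expand_det_col _ 0) big1 ?mul0r // => i _.
by rewrite mxE; case: splitP => // j _; rewrite mxE mul0r.
Qed.

Lemma prod_map_chain_det (s : r.+1.-tuple 'I_(m * n)) : pm (chain_det s) = 0.
Proof. exact: prod_map_det0. Qed.

Section SecondFundamentalTheorem.

Hypothesis r_gt0 : (0 < r)%N.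

Lemma reduce_chain p : has_chain r.+1 (mlead p) ->
  exists s : r.+1.-tuple 'I_(m * n), sorted (@before m n) s /\
  exists e, p - e * chain_det s = 0
    \/ (mlead (p - e * chain_det s) < mlead p)%O.
Proof.
case/existsP => s /andP [chain_s Ms]; exists s; split=> //.
apply: mlead_cancel; first exact: mleadc_chain_det.
by rewrite mlead_chain_det // chain_mnm_le.
Qed.

Lemma chain_det_in_ideal (t_gt0 : (0 < r.+1)%N) (s : r.+1.-tuple 'I_(m * n)) :
  sorted (@before m n) s -> chain_det s \in @det_ideal R m n r.+1 t_gt0.
Proof.
move=> chain_s; apply/asboolP.
have [f fE] : exists f : {ffun 'I_r.+1 -> 'I_m},
    forall i, f i = row_of (tnth s i).
  by exists [ffun i => row_of (tnth s i)] => i; rewrite ffunE.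
have [g gE] : exists g : {ffun 'I_r.+1 -> 'I_n},
    forall i, g i = col_of (tnth s i).
  by exists [ffun i => col_of (tnth s i)] => i; rewrite ffunE.
exists (fun f' g' => ((f' == f) && (g' == g))%:R).
have incr_f : increasing f.
  apply/forallP => i; apply/forallP => j; apply/implyP.
  move=> /(before_tnth chain_s).
  by rewrite !fE => /andP [].
have incr_g : increasing g.
  apply/forallP => i; apply/forallP => j; apply/implyP.
  move=> /(before_tnth chain_s).
  by rewrite !gE => /andP [].
have only_fg f' g' : (f' != f) || (g' != g) ->
    ((f' == f) && (g' == g))%:R * minor R f' g' = 0 :> {mpoly R[m * n]}.
  by rewrite -negb_and => /negPf ->; rewrite mul0r.
transitivity (minor R f g).
  by congr (\det _); apply/matrixP => i j; rewrite !mxE fE gE.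
symmetry; rewrite (bigD1 f incr_f) /=.
rewrite [X in _ + X]big1 ?addr0 => [|f' /andP [_ neq_f]]; last first.
  by rewrite big1 // => g' _; apply: only_fg; rewrite neq_f.
rewrite (bigD1 g incr_g) /= !eqxx mul1r [X in _ + X]big1 ?addr0 //.
by move=> g' /andP [_ neq_g]; rewrite (negPf neq_g) mul0r.
Qed.

(** Subtracting a multiple of a minor strips the leading monomial, which is not
    chainless, and does not leave the kernel. *)
Lemma ker_prod_map_sub (t_gt0 : (0 < r.+1)%N) p :
  pm p = 0 -> p \in @det_ideal R m n r.+1 t_gt0.
Proof.
have [I0 _ ID] := det_ideal_closed R m n t_gt0.
elim/mleadrect: p => p IH ker_p.
have [->|p_neq0] := eqVneq p 0; first exact: I0.
have [s [chain_s [e]]] := reduce_chain (mlead_ker_prod_map r_gt0 p_neq0 ker_p).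
set q := p - _ => q_small.
have -> : p = e * chain_det s + q by rewrite /q addrC subrK.
apply: ID; first exact: chain_det_in_ideal.
case: q_small => [->|lt_q]; first exact: I0.
apply: IH => //.
by rewrite /q rmorphB rmorphM /= prod_map_chain_det mulr0 subr0.
Qed.

Lemma reduce_mod_ker q :
  exists q', pm q' = pm q /\ (q' = 0 \/ ~~ has_chain r.+1 (mlead q')).
Proof.
elim/mleadrect: q => q IH.
have [/reduce_chain [s [_ [e]]]|] := boolP (has_chain r.+1 (mlead q));
  last by exists q; split=> //; right.
have same : pm (q - e * chain_det s) = pm q.
  by rewrite rmorphB rmorphM /= prod_map_chain_det mulr0 subr0.
case=> [z|/IH [q' [q'E q'P]]].
  by exists 0; split; [rewrite -same z | left].
by exists q'; rewrite q'E.
Qed.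

End SecondFundamentalTheorem.

(** * Corner minors form a regular sequence *)

Section RegularSequence.

Hypothesis r_gt0 : (0 < r)%N.

Variables s s' : r.-tuple 'I_(m * n).

Hypothesis chain_s : sorted (@before m n) s.
Hypothesis chain_s' : sorted (@before m n) s'.
Hypothesis corner_s : forall M,
  ~~ has_chain r.+1 M -> ~~ has_chain r.+1 (chain_mnm s + M)%MM.
Hypothesis corner_s' : forall M,
  ~~ has_chain r.+1 M -> ~~ has_chain r.+1 (chain_mnm s' + M)%MM.
Hypothesis disjoint_s : forall k, k \in s -> k \notin s'.

Let D := chain_det s.
Let D' := chain_det s'.

(** By induction on the leading monomial of [p].  If it is not chainless, or if
    the diagonal of [D] divides it, it can be stripped.  Otherwise make the
    leading monomial of [q] chainless too.  The leading monomials of [D' p] and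
    [D q] are then chainless, and they differ because the diagonal of [D]
    divides only the second; so [D' p - D q] has a chainless leading monomial,
    whereas it is in the kernel. *)
Lemma chain_det_regular p q : pm (D' * p) = pm (D * q) ->
  exists u, pm p = pm (D * u).
Proof.
have pmM : {morph pm : f g / f * g} := rmorphM pm.
have pmB : {morph pm : f g / f - g} := rmorphB pm.
elim/mleadrect: p q => p IH q eq_pq.
have [->|p_neq0] := eqVneq p 0; first by exists 0; rewrite mulr0.
have [/reduce_chain [t [_ [e]]]|chainless_p] :=
  boolP (has_chain r.+1 (mlead p)).
  have same : pm (p - e * chain_det t) = pm p.
    by rewrite pmB pmM prod_map_chain_det mulr0 subr0.
  case=> [z|/IH/(_ q)]; first by exists 0; rewrite -same z mulr0.
  by rewrite same; apply; rewrite pmM same -pmM.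
have [Dp|Dp] := boolP (chain_mnm s <= mlead p)%MM.
  have [] := @mlead_cancel _ _ p D; rewrite ?mlead_chain_det //.
    by rewrite -mlead_chain_det // mleadc_chain_det.
  (* [D' (p - e D) = D' p - D (D' e)] *)
  move=> e [/eqP|/IH/(_ (q - D' * e)) []].
  - by rewrite subr_eq0 => /eqP ->; exists e; rewrite mulrC.
  - by rewrite !mulrBr !pmB eq_pq mulrA (mulrC (D' * e)).
  move=> u /eqP; rewrite pmB subr_eq => /eqP ->; exists (u + e).
  by rewrite [e * D]mulrC mulrDr rmorphD.
have [q' [q'E q'P]] := reduce_mod_ker q.
have : pm (D' * p - D * q') = 0.
  by rewrite pmB eq_pq (pmM D q) (pmM D q') q'E subrr.
have lead_p := mleadM_chain_det chain_s' p_neq0.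
have D'p_neq0 : D' * p != 0.
  apply: contraNneq p_neq0 => D'p0.
  by apply/eqP/(lreg_chain_det chain_s'); rewrite mulr0.
have [q'0|q'_neq0] := eqVneq q' 0.
  rewrite q'0 mulr0 subr0 => /(mlead_ker_prod_map r_gt0 D'p_neq0).
  by rewrite lead_p (negPf (corner_s' chainless_p)).
case: q'P => [/eqP|chainless_q]; first by rewrite (negPf q'_neq0).
have lead_q := mleadM_chain_det chain_s q'_neq0.
have neq_lead : mlead (D' * p) != mlead (- (D * q')).
  rewrite mleadN lead_p lead_q; apply: contraNneq Dp => eq_lead.
  rewrite chain_mnm_le //; apply/allP => k ks.
  have /(_ k) := (mnmP _ _).1 eq_lead.
  by rewrite !mnmDE !chain_mnmE // ks (negPf (disjoint_s ks)) add0n => ->.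
have neq0 : D' * p - D * q' != 0.
  by apply: contraNneq neq_lead => /eqP; rewrite subr_eq0 mleadN => /eqP ->.
move=> /(mlead_ker_prod_map r_gt0 neq0); rewrite mleadD // mleadN.
case: leP => _; rewrite ?lead_p ?lead_q.
  by rewrite (negPf (corner_s chainless_q)).
by rewrite (negPf (corner_s' chainless_p)).
Qed.

End RegularSequence.

End ChainMinors.

Lemma strict_mono_ord (d m : nat) (f : 'I_d -> 'I_m) :
  (forall i j : 'I_d, (i < j)%N -> (f i < f j)%N) ->
  forall i : 'I_d, (i <= f i)%N && (f i + d <= m + i)%N.
Proof.
move=> mono_f i; apply/andP; split.
  case: i => k; elim: k => // k IH lt_k.
  by apply: leq_ltn_trans (IH (ltnW lt_k)) _; apply: mono_f => /=.
have [k] := ubnP (d - i)%N; elim: k i => // k IH i le_k.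
have [lt_i|ge_i] := ltnP i.+1 d; last first.
  by have := ltn_ord (f i); have := ltn_ord i; lia.
have := IH (Ordinal lt_i); have := @mono_f i (Ordinal lt_i); rewrite /=.
by move=> /(_ (ltnSn _)); lia.
Qed.

Section Corners.

Variables (m n r : nat).
Hypotheses (le_rm : (r <= m)%N) (le_rn : (r <= n)%N).

Lemma chain_bounds d (t : d.-tuple 'I_(m * n)) : sorted (@before m n) t ->
  forall a : 'I_d,
  [&& (a <= row_of (tnth t a))%N, (row_of (tnth t a) + d <= m + a)%N,
      (a <= col_of (tnth t a))%N & (col_of (tnth t a) + d <= n + a)%N].
Proof.
move=> chain_t a.
have /andP [-> ->] : (a <= row_of (tnth t a))%N
    && (row_of (tnth t a) + d <= m + a)%N.
  apply: (strict_mono_ord (f := fun a => row_of (tnth t a))) => i j.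
  by move=> /(before_tnth chain_t) /andP [].
apply: (strict_mono_ord (f := fun a => col_of (tnth t a))) => i j.
by move=> /(before_tnth chain_t) /andP [].
Qed.

Definition ne_corner : r.-tuple 'I_(m * n) :=
  [tuple mxvec_index (widen_ord le_rm k)
     (cast_ord (subnK le_rn) (rshift (n - r) k)) | k < r].

Definition sw_corner : r.-tuple 'I_(m * n) :=
  [tuple mxvec_index (cast_ord (subnK le_rm) (rshift (m - r) k))
     (widen_ord le_rn k) | k < r].

Lemma sorted_mktuple (T : Type) (e : rel T) d (f : 'I_d -> T) :
  (forall i j : 'I_d, (i < j)%N -> e (f i) (f j)) ->
  sorted e [tuple f k | k < d].
Proof.
move=> mono_f; case: d f mono_f => [|d] f mono_f; first by rewrite tuple0.
rewrite /= sorted_map.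
apply: sub_sorted (_ : sorted (relpre val ltn) (enum 'I_d.+1)).
  by move=> i j /mono_f.
by rewrite -sorted_map val_enum_ord iota_ltn_sorted.
Qed.

Lemma sorted_ne_corner : sorted (@before m n) ne_corner.
Proof.
apply: sorted_mktuple => i j ij.
by rewrite /before !row_of_index !col_of_index /= ltn_add2l ij.
Qed.

Lemma sorted_sw_corner : sorted (@before m n) sw_corner.
Proof.
apply: sorted_mktuple => i j ij.
by rewrite /before !row_of_index !col_of_index /= ltn_add2l ij.
Qed.

Lemma corner_disjoint k : (r < m)%N -> k \in ne_corner -> k \notin sw_corner.
Proof.
move=> lt_rm /mapP [i _ ->]; apply/negP => /mapP [j _ /eqP].
rewrite eq_mxvec_index -!val_eqE /= => /andP [/eqP ei /eqP ej].
lia.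
Qed.

Lemma chainless_add_corner (s : r.-tuple 'I_(m * n)) M :
  sorted (@before m n) s ->
  (forall (t : r.+1.-tuple 'I_(m * n)) k,
     sorted (@before m n) t -> k \in s -> k \notin t) ->
  ~~ has_chain r.+1 M -> ~~ has_chain r.+1 (chain_mnm s + M)%MM.
Proof.
move=> chain_s off_s; apply: contra => /existsP [t /andP [chain_t sMt]].
apply/existsP; exists t; rewrite chain_t; apply/allP => k kt.
have := allP sMt k kt; rewrite mnmDE chain_mnmE //.
by case: (boolP (k \in s)) => // /(off_s _ _ chain_t); rewrite kt.
Qed.

(** A chain of length [r + 1] through the position [(i, j)] as its term of index
    [a] has [a <= i] and needs [r - a] further columns on the right of [j]; on
    the north-east diagonal [j = n - r + i], there are only [r - 1 - i]. *)
Lemma ne_corner_off_chains (t : r.+1.-tuple 'I_(m * n)) k :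
  sorted (@before m n) t -> k \in ne_corner -> k \notin t.
Proof.
move=> chain_t /mapP [i _ ->]; apply/negP => /tnthP [a eq_a].
have := chain_bounds chain_t a; rewrite -eq_a row_of_index col_of_index /=.
lia.
Qed.

(** The same count with rows and columns exchanged. *)
Lemma sw_corner_off_chains (t : r.+1.-tuple 'I_(m * n)) k :
  sorted (@before m n) t -> k \in sw_corner -> k \notin t.
Proof.
move=> chain_t /mapP [i _ ->]; apply/negP => /tnthP [a eq_a].
have := chain_bounds chain_t a; rewrite -eq_a row_of_index col_of_index /=.
lia.
Qed.

End Corners.

Section BlocksOfAChain.

Variables (R : comNzRingType) (m n r : nat) (s : r.-tuple 'I_(m * n)).
Hypothesis chain_s : sorted (@before m n) s.

Definition chain_rows : 'M[{mpoly R[nvarsM m n r]}]_r :=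
  rowsub (fun i => row_of (tnth s i)) (wmx R m n r).
Definition chain_cols : 'M[{mpoly R[nvarsM m n r]}]_r :=
  colsub (fun j => col_of (tnth s j)) (vmx R m n r).

Lemma prod_map_chain_detM :
  prod_map r (chain_det R s) = \det chain_rows * \det chain_cols.
Proof. by rewrite /chain_det -det_map_mx map_prod_map_mxsub det_mulmx. Qed.

Lemma lreg_chain_rows : GRing.lreg (\det chain_rows).
Proof.
have -> : chain_rows = \matrix_(i, j) 'X_(wvar n (row_of (tnth s i)) j).
  by apply/matrixP => i j; rewrite !mxE.
apply: lreg_det_diagonal => i j i' j' lt_ij; rewrite /wvar /=.
apply: ltn_mxvec_index; case/orP: lt_ij => [|/andP [/eqP-> ->]].
  by move=> /(before_tnth chain_s) /andP [->].
by rewrite eqxx orbT.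
Qed.

Lemma lreg_chain_cols : GRing.lreg (\det chain_cols).
Proof.
have -> : chain_cols = \matrix_(i, j) 'X_(vvar m i (col_of (tnth s j))).
  by apply/matrixP => i j; rewrite !mxE.
apply: lreg_det_diagonal => i j i' j' lt_ij; rewrite /vvar /= ltn_add2l.
apply: ltn_mxvec_index; case/orP: lt_ij => [->//|/andP [/eqP-> ]].
by move=> /(before_tnth chain_s) /andP [_ ->]; rewrite eqxx orbT.
Qed.

Lemma lreg_prod_map_chain_det : GRing.lreg (prod_map r (chain_det R s)).
Proof.
by rewrite prod_map_chain_detM; apply: lregM lreg_chain_rows lreg_chain_cols.
Qed.

End BlocksOfAChain.

(** * Localization at one element *)

Section Localization.

Variables (R : comNzRingType) (C : comAlgType R) (delta : C).
Hypothesis reg_delta : GRing.lreg delta.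

(** [C[1/delta]] as the quotient of [C['X]] by the multiples of [1 - delta 'X].
    Regularity of [delta] keeps this ideal proper. *)
Definition loc_ideal of GRing.lreg delta : {pred {poly C}} := fun p =>
  `[< exists u, p = u * (1 - delta%:P * 'X) >].

(** If [c = u (1 - delta 'X)], the coefficients of [u] are the [delta ^ k c];
    they vanish for large [k]. *)
Lemma loc_ideal_const (c : C) : c%:P \in loc_ideal reg_delta -> c = 0.
Proof.
case/asboolP => u uE.
have coef_u k : u`_k = delta ^+ k * c.
  have step i : u`_i = (c%:P)`_i + delta * (if i == 0%N then 0 else u`_i.-1).
    rewrite uE mulrBr mulr1 mulrA coefB coefMX [u * _]mulrC.
    by case: eqP => _; rewrite ?mulr0 ?addr0 ?subr0 // coefCM subrK.
  elim: k => [|k IH]; rewrite step coefC /= ?mulr0 ?addr0 ?mul1r //.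
  by rewrite add0r IH exprS mulrA.
have := coef_u (size u); rewrite nth_default // => /esym.
elim: (size u) => [|k IH]; first by rewrite mul1r.
by rewrite exprS -mulrA -[RHS](mulr0 delta) => /reg_delta.
Qed.

Lemma loc_ideal_closed : idealr_closed (loc_ideal reg_delta).
Proof.
split.
- by apply/asboolP; exists 0; rewrite mul0r.
- by apply/negP; rewrite -polyC1 => /loc_ideal_const/eqP; rewrite oner_eq0.
- move=> a p q /asboolP [u ->] /asboolP [v ->]; apply/asboolP.
  by exists (a * u + v); rewrite mulrDl mulrA.
Qed.

HB.instance Definition _ :=
  isIdealr.Build {poly C} (loc_ideal reg_delta) loc_ideal_closed.

Definition loc_ring : Type := {ideal_quot (loc_ideal reg_delta)}.

HB.instance Definition _ := GRing.ComNzRing.on loc_ring.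

Definition loc_pi : {poly C} -> loc_ring :=
  \pi_{ideal_quot (loc_ideal reg_delta)}.

HB.instance Definition _ := GRing.RMorphism.on loc_pi.

Definition loc_inj : C -> loc_ring := loc_pi \o polyC.

HB.instance Definition _ := GRing.RMorphism.on loc_inj.

Definition loc_scale (a : R) (u : loc_ring) : loc_ring := loc_inj a%:A * u.

Fact loc_scaleA a b u : loc_scale a (loc_scale b u) = loc_scale (a * b) u.
Proof. by rewrite /loc_scale mulrA -rmorphM /= -scalerAl mul1r scalerA. Qed.

Fact loc_scale1 : left_id 1 loc_scale.
Proof. by move=> u; rewrite /loc_scale scale1r rmorph1 mul1r. Qed.

Fact loc_scaleDr : right_distributive loc_scale +%R.
Proof. by move=> a u v; rewrite /loc_scale mulrDr. Qed.

Fact loc_scaleDl u : {morph loc_scale^~ u : a b / a + b}.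
Proof. by move=> a b; rewrite /loc_scale scalerDl rmorphD mulrDl. Qed.

HB.instance Definition _ := GRing.Zmodule_isLmodule.Build R loc_ring
  loc_scaleA loc_scale1 loc_scaleDr loc_scaleDl.

Fact loc_scaleAl (a : R) (u v : loc_ring) : a *: (u * v) = (a *: u) * v.
Proof. exact: mulrA. Qed.

HB.instance Definition _ := GRing.Lmodule_isLalgebra.Build R loc_ring
  loc_scaleAl.
HB.instance Definition _ := GRing.Lalgebra_isComAlgebra.Build R loc_ring.

Lemma loc_inj_injective : injective loc_inj.
Proof.
move=> a b /eqP; rewrite -subr_eq0 -rmorphB /= => /eqP.
have <- : loc_pi 0 = 0 by rewrite rmorph0.
move=> /eqP; rewrite -Quotient.idealrBE subr0 => /loc_ideal_const/eqP.
by rewrite subr_eq0 => /eqP.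
Qed.

Lemma loc_injC a : loc_inj a%:A = a%:A.
Proof. by rewrite -[LHS]mulr1. Qed.

Lemma loc_inj_unit : loc_inj delta * loc_pi 'X = 1.
Proof.
apply/esym/eqP; rewrite -subr_eq0 /loc_inj /= -rmorphM.
rewrite -(rmorph1 loc_pi) -rmorphB.
have <- : loc_pi 0 = 0 by rewrite rmorph0.
rewrite -Quotient.idealrBE subr0; apply/asboolP.
by exists 1; rewrite mul1r.
Qed.

End Localization.

Lemma localization_exists (R : comNzRingType) (C : comAlgType R) (delta : C) :
  GRing.lreg delta ->
  exists (A : comAlgType R) (iota : {rmorphism C -> A}) (y : A),
    [/\ injective iota, forall a : R, iota a%:A = a%:A & iota delta * y = 1].
Proof.
move=> reg; exists (loc_ring reg), (loc_inj reg), (loc_pi reg 'X).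
by split; [apply: loc_inj_injective | apply: loc_injC | apply: loc_inj_unit].
Qed.

(** * Invariants have bounded denominators *)

Lemma rmorph_mpoly_eq (N : nat) (R : comNzRingType) (T : nzRingType)
    (F G : {rmorphism {mpoly R[N]} -> T}) :
  (forall c, F c%:MP = G c%:MP) -> (forall k, F 'X_k = G 'X_k) -> F =1 G.
Proof.
move=> FGC FGX p; rewrite [p]mpolyE !rmorph_sum; apply: eq_bigr => M _.
rewrite -mul_mpolyC !rmorphM FGC; congr (_ * _).
rewrite mpolyXE_id !rmorph_prod; apply: eq_bigr => k _.
by rewrite !rmorphXn FGX.
Qed.

Lemma row_mx_mxvec_ind (A : nzRingType) m n r (P : A -> Prop)
    (X : 'M[A]_(m, r)) (Y : 'M[A]_(r, n)) :
  (forall i l, P (X i l)) -> (forall l j, P (Y l j)) ->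
  forall k, P (row_mx (mxvec X) (mxvec Y) 0 k).
Proof.
move=> PX PY k; case: (split_ordP k) => k' ->.
  by rewrite row_mxEl; case/mxvec_indexP: k' => i l; rewrite mxvecE.
by rewrite row_mxEr; case/mxvec_indexP: k' => l j; rewrite mxvecE.
Qed.

Section Fractions.

Variables (R : comNzRingType) (B C : comAlgType R) (A : comAlgType R).
Variables (pm : {lrmorphism B -> C}) (iota : {rmorphism C -> A}) (b : B).
Hypothesis iotaC : forall a : R, iota a%:A = a%:A.

(** The elements of the localization of the image of [pm] at [pm b]. *)
Definition bounded_fraction (z : A) : Prop :=
  exists k u, iota (pm b) ^+ k * z = iota (pm u).

Lemma bounded_fractionC (a : R) : bounded_fraction a%:A.
Proof.
by exists 0%N, a%:A; rewrite mul1r linearZ /= rmorph1 iotaC.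
Qed.

Lemma bounded_fractionD z1 z2 :
  bounded_fraction z1 -> bounded_fraction z2 -> bounded_fraction (z1 + z2).
Proof.
move=> [k1 [u1 z1E]] [k2 [u2 z2E]].
exists (k1 + k2)%N, (b ^+ k2 * u1 + b ^+ k1 * u2).
rewrite !rmorphD !rmorphM !rmorphXn /= -z1E -z2E exprD; ring.
Qed.

Lemma bounded_fractionM z1 z2 :
  bounded_fraction z1 -> bounded_fraction z2 -> bounded_fraction (z1 * z2).
Proof.
move=> [k1 [u1 z1E]] [k2 [u2 z2E]]; exists (k1 + k2)%N, (u1 * u2).
rewrite !rmorphM /= -z1E -z2E exprD; ring.
Qed.

Lemma bounded_fraction_meval N (f : {mpoly R[N]}) (z : 'I_N -> A) :
  (forall i, bounded_fraction (z i)) ->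
  bounded_fraction (map_mpoly (in_alg A) f).@[z].
Proof.
move=> zB; rewrite mevalE; elim/big_ind: _ => [|x y|M _].
- by rewrite -(scale0r 1); apply: bounded_fractionC.
- exact: bounded_fractionD.
rewrite mcoeff_map_mpoly; apply: bounded_fractionM.
  exact: bounded_fractionC.
have one : bounded_fraction 1 by rewrite -(scale1r 1); apply: bounded_fractionC.
elim/big_ind: _ => [//|x y|i _]; first exact: bounded_fractionM.
by elim: (M i) => // k IH; rewrite exprS; apply: bounded_fractionM.
Qed.

End Fractions.

Section Invariants.

Variables (R : comNzRingType) (m n r : nat).

Local Notation N := (nvarsM m n r).
Local Notation pm := (@prod_map R m n r).

Lemma meval_map_mpoly_vars (A : comAlgType R)
    (iota : {rmorphism {mpoly R[N]} -> A}) f :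
  (forall a : R, iota a%:A = a%:A) ->
  (map_mpoly (in_alg A) f).@[fun k => iota 'X_k] = iota f.
Proof.
move=> iotaC; pose F : {rmorphism {mpoly R[N]} -> A} :=
  meval (fun k => iota 'X_k) \o map_mpoly (in_alg A).
apply: (rmorph_mpoly_eq (F := F)) => [c|k] /=.
  by rewrite map_mpolyC mevalC -[c%:MP]mulr1 mul_mpolyC iotaC.
by rewrite map_mpolyX mevalXU.
Qed.

(** The group element is [g], the block of rows of [W] picked by [s], over the
    localization where it is invertible.  Up to the minor [D] of [s], the
    entries of [W g^-1] are those of the columns of [W V] picked by [s] times
    the adjugate of the matrix of [D]. *)
Lemma invariant_bounded_denominator (s : r.-tuple 'I_(m * n)) f :
  sorted (@before m n) s -> f \in @GL_invariant R m n r ->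
  exists k p, pm (chain_det R s) ^+ k * f = pm p.
Proof.
move=> chain_s /asboolP inv_f.
have [A [iota [y [iota_inj iotaC iota_y]]]] :=
  localization_exists (lreg_chain_rows (R := R) chain_s).
pose W := wmx R m n r; pose V := vmx R m n r.
pose g : 'M[A]_r := map_mx iota (chain_rows R s).
pose ginv : 'M[A]_r := y *: map_mx iota (\adj (chain_rows R s)).
have gK : g *m ginv = 1%:M.
  rewrite -scalemxAr -map_mxM mul_mx_adj map_scalar_mx -mul_scalar_mx.
  by rewrite -scalar_mxM mulrC iota_y.
have Kg : ginv *m g = 1%:M.
  rewrite -scalemxAl -map_mxM mul_adj_mx map_scalar_mx -mul_scalar_mx.
  by rewrite -scalar_mxM mulrC iota_y.
have := congr1 (meval (fun k => iota 'X_k)) (inv_f A g ginv gK Kg).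
rewrite meval_map_mpoly_vars // /actM /substM comp_mpoly_meval => fE.
suff [k [p]] : bounded_fraction pm iota (chain_det R s) (iota f).
  by rewrite -rmorphXn -rmorphM => /iota_inj; exists k, p.
rewrite -fE; apply: bounded_fraction_meval => // i; rewrite tnth_mktuple.
pose ev := meval (fun k : 'I_N => iota 'X_k).
have evW : map_mx ev (wmx A m n r *m map_mx (@mpolyC N A) ginv)
    = map_mx iota W *m ginv.
  rewrite map_mxM; congr (_ *m _); apply/matrixP => a b; rewrite !mxE.
    exact: mevalXU.
  exact: mevalC.
have evV : map_mx ev (map_mx (@mpolyC N A) g *m vmx A m n r)
    = g *m map_mx iota V.
  rewrite map_mxM; congr (_ *m _); apply/matrixP => a b; rewrite !mxE.
    exact: mevalC.
  exact: mevalXU.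
move: i; apply: (row_mx_mxvec_ind
  (P := fun z => bounded_fraction pm iota (chain_det R s) (ev z))) => [i l|l j].
  have -> : ev ((wmx A m n r *m map_mx (@mpolyC N A) ginv) i l)
      = (map_mx iota W *m ginv) i l by rewrite -evW [RHS]mxE.
  pose X := xmx R m n; pose colX := colsub (fun b => col_of (tnth s b)) X.
  pose Xs := mxsub (fun a => row_of (tnth s a)) (fun b => col_of (tnth s b)) X.
  exists 1%N, ((colX *m \adj Xs) i l).
  have pmX : map_mx pm Xs = chain_rows R s *m chain_cols R s.
    exact: map_prod_map_mxsub.
  have pmd : pm (chain_det R s) = \det (map_mx pm Xs) by rewrite det_map_mx.
  have pmcol : map_mx pm colX = W *m chain_cols R s.
    by rewrite map_prod_map_mxsub mxsub_id.
  (* [V_s adj (W_s V_s) = D W_s^-1], for the blocks [W_s] and [V_s] of [s] *)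
  have key : map_mx iota (chain_cols R s *m \adj (map_mx pm Xs))
      = iota (pm (chain_det R s)) *: ginv.
    rewrite -[LHS]mul1mx -Kg -mulmxA -map_mxM mulmxA -pmX mul_mx_adj -pmd.
    by rewrite map_scalar_mx mul_mx_scalar.
  have : map_mx iota (map_mx pm (colX *m \adj Xs))
      = iota (pm (chain_det R s)) *: (map_mx iota W *m ginv).
    by rewrite map_mxM pmcol map_mx_adj -mulmxA map_mxM key -scalemxAr.
  by move=> /matrixP /(_ i l); rewrite [LHS]mxE [in LHS]mxE [RHS]mxE => ->.
have -> : ev ((map_mx (@mpolyC N A) g *m vmx A m n r) l j)
    = (g *m map_mx iota V) l j by rewrite -evV [RHS]mxE.
exists 0%N, (xmx R m n (row_of (tnth s l)) j); rewrite mul1r.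
transitivity (iota ((W *m V) (row_of (tnth s l)) j)); last first.
  by apply: (congr1 iota); rewrite -prod_map_xmx.
rewrite -map_mxM mxE; apply: (congr1 iota); rewrite !mxE.
by apply: eq_bigr => c _; rewrite !mxE.
Qed.

End Invariants.

(** * The two fundamental theorems *)

Section FirstFundamentalTheorem.

Variables (R : comNzRingType) (m n r : nat).

Local Notation N := (nvarsM m n r).
Local Notation pm := (@prod_map R m n r).

Lemma prod_map_invariant p : pm p \in @GL_invariant R m n r.
Proof.
apply/asboolP => A g ginv _ Kg; rewrite /actM /substM.
pose lq := [tuple row_mx (mxvec (wmx A m n r *m map_mx (@mpolyC N A) ginv))
  (mxvec (map_mx (@mpolyC N A) g *m vmx A m n r)) 0 k | k < N].
rewrite -/lq.
pose F : {rmorphism {mpoly R[m * n]} -> {mpoly A[N]}} :=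
  comp_mpoly lq \o (map_mpoly (in_alg A) \o pm).
pose G : {rmorphism {mpoly R[m * n]} -> {mpoly A[N]}} :=
  map_mpoly (in_alg A) \o pm.
apply: (rmorph_mpoly_eq (F := F) (G := G)) => [c|k] /=.
  by rewrite /prod_map !comp_mpolyC map_mpolyC comp_mpolyC.
case/mxvec_indexP: k => i j.
have -> : pm 'X_(mxvec_index i j) = (wmx R m n r *m vmx R m n r) i j.
  by rewrite -prod_map_xmx mxE.
have mapW : map_mx (map_mpoly (in_alg A)) (wmx R m n r) = wmx A m n r.
  by apply/matrixP => a b; rewrite !mxE map_mpolyX.
have mapV : map_mx (map_mpoly (in_alg A)) (vmx R m n r) = vmx A m n r.
  by apply/matrixP => a b; rewrite !mxE map_mpolyX.
have -> : map_mpoly (in_alg A) ((wmx R m n r *m vmx R m n r) i j)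
    = (wmx A m n r *m vmx A m n r) i j by rewrite -mapW -mapV -map_mxM [RHS]mxE.
have actW : map_mx (comp_mpoly lq) (wmx A m n r)
    = wmx A m n r *m map_mx (@mpolyC N A) ginv.
  apply/matrixP => a b; rewrite mxE [in LHS]mxE comp_mpolyXU nth_mktuple.
  by rewrite row_mxEl mxvecE.
have actV : map_mx (comp_mpoly lq) (vmx A m n r)
    = map_mx (@mpolyC N A) g *m vmx A m n r.
  apply/matrixP => a b; rewrite mxE [in LHS]mxE comp_mpolyXU nth_mktuple.
  by rewrite row_mxEr mxvecE.
transitivity (map_mx (comp_mpoly lq) (wmx A m n r *m vmx A m n r) i j).
  by rewrite [RHS]mxE.
rewrite map_mxM actW actV mulmxA -(mulmxA (wmx A m n r)) -map_mxM Kg.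
by rewrite map_mx1 mulmx1.
Qed.

(** A fraction with a power of [D] and a power of [D'] as denominators has no
    denominator, because [D, D'] is a regular sequence. *)
Lemma invariant_prod_map f : (0 < r)%N -> (r < m)%N -> (r <= n)%N ->
  f \in @GL_invariant R m n r -> exists p, f = pm p.
Proof.
move=> r_gt0 lt_rm le_rn inv_f; have le_rm := ltnW lt_rm.
pose s := ne_corner le_rm le_rn; pose s' := sw_corner le_rm le_rn.
have chain_s : sorted (@before m n) s := sorted_ne_corner _ _.
have chain_s' : sorted (@before m n) s' := sorted_sw_corner _ _.
pose D := chain_det R s; pose D' := chain_det R s'.
have pmM : {morph pm : f g / f * g} := rmorphM pm.
have [a [p pE]] := invariant_bounded_denominator chain_s inv_f.
have [b [q qE]] := invariant_bounded_denominator chain_s' inv_f.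
have regular x y : pm (D' * x) = pm (D * y) -> exists u, pm x = pm (D * u).
  apply: (chain_det_regular r_gt0 chain_s chain_s') => [M|M|k].
  - by apply: chainless_add_corner => // t k; apply: ne_corner_off_chains.
  - by apply: chainless_add_corner => // t k; apply: sw_corner_off_chains.
  - exact: corner_disjoint.
have regular_pow e x y :
  pm (D' ^+ e * x) = pm (D * y) -> exists u, pm x = pm (D * u).
  elim: e y => [|e IH] y; first by rewrite mul1r; exists y.
  by rewrite exprS -mulrA => /regular [u /IH].
have reg_D := lreg_prod_map_chain_det (R := R) chain_s.
(* The denominator [D ^ a] is removed one factor at a time. *)
have {qE} : pm (D' ^+ b * p) = pm D ^+ a * pm q.
  by rewrite pmM rmorphXn /= -pE -qE mulrCA.
elim: a p q pE => [|a IH] p q pE; first by exists p; rewrite -pE mul1r.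
rewrite exprS -mulrA -rmorphXn -!pmM => pqE.
have [u pu] := regular_pow b _ _ pqE.
apply: (IH u q).
  by apply: reg_D; rewrite -pmM -pu -pE exprS mulrA.
apply: reg_D; rewrite -rmorphXn -!pmM -pqE.
by rewrite [in RHS]pmM pu -pmM mulrCA.
Qed.

End FirstFundamentalTheorem.

Section CanonicalMap.

Variables (R : comNzRingType) (m n r : nat).
Hypothesis t_gt0 : (0 < r.+1)%N.

Local Notation pm := (@prod_map R m n r).
Local Notation Q := (det_ring R m n t_gt0).
Local Notation pi := (@det_pi R m n r.+1 t_gt0).

Definition canonical_map (u : Q) : inv_ring R m n r :=
  InvRing (prod_map_invariant r (generic_quotient.repr u)).

Lemma prod_map_det_ideal p : p \in @det_ideal R m n r.+1 t_gt0 -> pm p = 0.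
Proof.
case/asboolP => c ->; rewrite rmorph_sum big1 // => f _.
rewrite rmorph_sum big1 // => g _.
by rewrite rmorphM [X in _ * X]prod_map_det0 mulr0.
Qed.

Lemma prod_map_repr p : pm (generic_quotient.repr (pi p)) = pm p.
Proof.
apply/eqP; rewrite -subr_eq0 -rmorphB; apply/eqP/prod_map_det_ideal.
by rewrite Quotient.idealrBE reprK.
Qed.

Lemma inv_val_canonical_map p : inv_val (canonical_map (pi p)) = pm p.
Proof. exact: prod_map_repr. Qed.

Lemma det_piP (u : Q) : exists p, u = pi p.
Proof. by exists (generic_quotient.repr u); rewrite [RHS]reprK. Qed.

Fact canonical_map_zmod : zmod_morphism canonical_map.
Proof.
move=> u v; have [[p ->] [q ->]] := (det_piP u, det_piP v).
apply: val_inj; rewrite [RHS]rmorphB /= -(rmorphB pi) !prod_map_repr.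
exact: rmorphB.
Qed.

Fact canonical_map_monoid : monoid_morphism canonical_map.
Proof.
split=> [|u v].
  apply: val_inj; rewrite [RHS]rmorph1 /= -(rmorph1 pi) prod_map_repr.
  exact: rmorph1.
have [[p ->] [q ->]] := (det_piP u, det_piP v).
apply: val_inj; rewrite [RHS]rmorphM /= -(rmorphM pi) !prod_map_repr.
exact: rmorphM.
Qed.

Fact canonical_map_scalable : scalable canonical_map.
Proof.
move=> a u; have [p ->] := det_piP u.
apply: val_inj; rewrite -(linearZ_LR pi) [RHS]linearZ_LR /= !prod_map_repr.
exact: linearZ_LR.
Qed.

HB.instance Definition _ := GRing.isZmodMorphism.Build Q (inv_ring R m n r)
  canonical_map canonical_map_zmod.
HB.instance Definition _ := GRing.isMonoidMorphism.Build Q (inv_ring R m n r)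
  canonical_map canonical_map_monoid.
HB.instance Definition _ := GRing.isScalable.Build R Q (inv_ring R m n r) *:%R
  canonical_map canonical_map_scalable.

Lemma canonical_map_inj : (0 < r)%N -> injective canonical_map.
Proof.
move=> r_gt0 u v; have [[p ->] [q ->]] := (det_piP u, det_piP v).
move=> /(congr1 (fun f => inv_val f)) /=; rewrite !prod_map_repr => /eqP.
rewrite -subr_eq0 -rmorphB => /eqP/(ker_prod_map_sub r_gt0 t_gt0).
by rewrite Quotient.idealrBE => /eqP.
Qed.

Lemma canonical_map_surj (f : inv_ring R m n r) :
  (0 < r)%N -> (r < m)%N -> (r <= n)%N -> exists u, canonical_map u = f.
Proof.
case: f => f inv_f r_gt0 lt_rm le_rn.
have [p fE] := invariant_prod_map r_gt0 lt_rm le_rn inv_f.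
by exists (pi p); apply: val_inj; rewrite /= prod_map_repr fE.
Qed.

End CanonicalMap.

Theorem theorem8 (R : comNzRingType) (m n t : nat)
    (t_ge2 : (2 <= t)%N) (t_le_m : (t <= m)%N) (m_le_n : (m <= n)%N) :
  exists Phi : {lrmorphism det_ring R m n (ltnW t_ge2) -> inv_ring R m n t.-1},
    (forall (i : 'I_m) (j : 'I_n),
       inv_val (Phi (det_pi (ltnW t_ge2) (xmx R m n i j)))
       = \sum_(l < t.-1) wmx R m n t.-1 i l * vmx R m n t.-1 l j)
    /\ bijective Phi.
Proof.
case: t t_ge2 t_le_m => [//|r] r_gt0 lt_rm; set t_gt0 := ltnW r_gt0.
exists (@canonical_map R m n r t_gt0 : {lrmorphism _ -> _}); split=> [i j|].
  by rewrite inv_val_canonical_map prod_map_xmx mxE.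
have le_rn : (r <= n)%N := leq_trans (ltnW lt_rm) m_le_n.
have surj (f : inv_ring R m n r) :=
  canonical_map_surj t_gt0 f r_gt0 lt_rm le_rn.
have [inv invK] := choice surj; exists inv => // u.
by apply: canonical_map_inj; rewrite ?invK.
Qed.
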